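(* For each integer $n \geq 1$, the group $\Gamma_n = \langle a,b : b a^n b = a\rangle$ admits the decomposition $$\Gamma_n = \langle a,b\rangle^+ \sqcup \langle a^{-1},b^{-1}\rangle^+ \sqcup \{id\},$$ that is, the three sets on the right-hand side are pairwise disjoint and their union is $\Gamma_n$.
   Context: For elements $g_1,\ldots,g_k$ of a group, $\langle g_1,\ldots,g_k\rangle^+$ denotes the semigroup generated by $\{g_1,\ldots,g_k\}$, i.e. the set of all elements that are products of one or more factors from $\{g_1,\ldots,g_k\}$ (no inverses allowed; the empty product is not included). The symbol $\sqcup$ denotes disjoint union, and $id$ is the identity element. *)

(* Defs.v *)
From HB Require Import structures.
From mathcomp Require Import all_boot.
From mathcomp Require Import boolp classical_sets.

Set Implicit Arguments.
Unset Strict Implicit.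
Unset Printing Implicit Defensive.

Local Open Scope group_scope.
Local Open Scope quotient_scope.
Local Open Scope classical_set_scope.

(* A word in the letters x and x^-1, for x : T: the letter x is (x, false)    *)
(* and the letter x^-1 is (x, true).                                          *)
Notation word T := (seq (T * bool)).

(* The least congruence on words that contains E and the free cancellations;  *)
(* the group presented by <T : u = v for E u v> is the quotient of the words  *)
(* by it.                                                                     *)
Inductive pres_cong (T : Type) (E : word T -> word T -> Prop) :
    word T -> word T -> Prop :=
| Cong_rel u v of E u v : pres_cong E u v
| Cong_cancel x e : pres_cong E [:: (x, e); (x, ~~ e)] [::]
| Cong_cat u u' v v' of pres_cong E u u' & pres_cong E v v' :
    pres_cong E (u ++ v) (u' ++ v')
| Cong_refl u : pres_cong E u u
| Cong_sym u v of pres_cong E u v : pres_cong E v u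
| Cong_trans v u w of pres_cong E u v & pres_cong E v w : pres_cong E u w.

Definition pres_eqv (T : choiceType) (E : word T -> word T -> Prop) :
  rel (word T) := fun u v => `[< pres_cong E u v >].

Lemma pres_eqv_equiv (T : choiceType) (E : word T -> word T -> Prop) :
  equiv_class_of (pres_eqv E).
Proof.
split=> [u|u v|v u w]; first by apply/asboolP/Cong_refl.
- by apply/asboolP/asboolP; apply: Cong_sym.
- by move=> /asboolP uv /asboolP vw; apply/asboolP/(Cong_trans uv).
Qed.

Canonical pres_equiv_rel (T : choiceType) (E : word T -> word T -> Prop) :=
  EquivRelPack (pres_eqv_equiv E).

Definition presented (T : choiceType) (E : word T -> word T -> Prop) :=
  {eq_quot pres_equiv_rel E}.

HB.instance Definition _ (T : choiceType) (E : word T -> word T -> Prop) :=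
  Choice.copy (presented E) {eq_quot pres_equiv_rel E}.

Definition pres_class (T : choiceType) (E : word T -> word T -> Prop)
  (u : word T) : presented E := \pi_{eq_quot pres_equiv_rel E} u.

Definition pres_repr (T : choiceType) (E : word T -> word T -> Prop)
  (x : presented E) : word T := @repr _ {eq_quot pres_equiv_rel E} x.

Lemma pres_reprK (T : choiceType) (E : word T -> word T -> Prop)
  (x : presented E) : pres_class E (pres_repr x) = x.
Proof. exact: reprK. Qed.

Lemma pres_classP (T : choiceType) (E : word T -> word T -> Prop) u v :
  pres_class E u = pres_class E v <-> pres_cong E u v.
Proof. by split=> [/eqmodP/asboolP//|uv]; apply/eqmodP/asboolP. Qed.

Lemma pres_repr_cong (T : choiceType) (E : word T -> word T -> Prop) u :
  pres_cong E (pres_repr (pres_class E u)) u.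
Proof. by apply/pres_classP; rewrite pres_reprK. Qed.

Definition word_inv (T : Type) (u : word T) : word T :=
  rev [seq (l.1, ~~ l.2) | l <- u].

Lemma word_invK (T : Type) : involutive (@word_inv T).
Proof.
move=> u; rewrite /word_inv map_rev revK -map_comp.
by elim: u => //= -[x e] u ->; rewrite /= negbK.
Qed.

Lemma word_mulV (T : Type) (E : word T -> word T -> Prop) u :
  pres_cong E (u ++ word_inv u) [::].
Proof.
elim: u => [|[x e] u IHu]; first exact: Cong_refl.
have -> : ((x, e) :: u) ++ word_inv ((x, e) :: u)
          = [:: (x, e)] ++ ((u ++ word_inv u) ++ [:: (x, ~~ e)]).
  by rewrite /word_inv /= rev_cons -cats1 catA.
apply: (Cong_trans _ (Cong_cancel E x e)); apply: Cong_cat (Cong_refl E _) _.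
exact: Cong_cat IHu (Cong_refl E _).
Qed.

Lemma word_mulV' (T : Type) (E : word T -> word T -> Prop) u :
  pres_cong E (word_inv u ++ u) [::].
Proof. by rewrite -{2}[u]word_invK; apply: word_mulV. Qed.

Lemma word_inv_cong (T : Type) (E : word T -> word T -> Prop) u v :
  pres_cong E u v -> pres_cong E (word_inv u) (word_inv v).
Proof.
move=> uv; apply: (@Cong_trans _ _ (word_inv u ++ (v ++ word_inv v))).
  rewrite -[X in pres_cong _ X]cats0; apply/Cong_cat/Cong_sym/word_mulV.
  exact: Cong_refl.
rewrite catA -[X in pres_cong _ _ X]cat0s.
apply: Cong_cat; last exact: Cong_refl.
apply: (@Cong_trans _ _ (word_inv u ++ u)); last exact: word_mulV'.
by apply: Cong_cat; [exact: Cong_refl | exact: Cong_sym].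
Qed.

Definition pres_one (T : choiceType) (E : word T -> word T -> Prop) :=
  pres_class E [::].

Definition pres_mul (T : choiceType) (E : word T -> word T -> Prop)
    (x y : presented E) :=
  pres_class E (pres_repr x ++ pres_repr y).

Definition pres_inv (T : choiceType) (E : word T -> word T -> Prop)
    (x : presented E) :=
  pres_class E (word_inv (pres_repr x)).

Lemma pres_mul_class (T : choiceType) (E : word T -> word T -> Prop) u v :
  pres_mul (pres_class E u) (pres_class E v) = pres_class E (u ++ v).
Proof. by apply/pres_classP/Cong_cat; apply: pres_repr_cong. Qed.

Lemma pres_inv_class (T : choiceType) (E : word T -> word T -> Prop) u :
  pres_inv (pres_class E u) = pres_class E (word_inv u).
Proof. exact/pres_classP/word_inv_cong/pres_repr_cong. Qed.

Lemma pres_mulA (T : choiceType) (E : word T -> word T -> Prop) :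
  associative (@pres_mul T E).
Proof.
move=> x y z; rewrite -[x]pres_reprK -[y]pres_reprK -[z]pres_reprK.
by rewrite !pres_mul_class catA.
Qed.

Lemma pres_mul1 (T : choiceType) (E : word T -> word T -> Prop) :
  left_id (pres_one E) (@pres_mul T E).
Proof. by move=> x; rewrite -[x]pres_reprK pres_mul_class. Qed.

Lemma pres_mulr1 (T : choiceType) (E : word T -> word T -> Prop) :
  right_id (pres_one E) (@pres_mul T E).
Proof. by move=> x; rewrite -[x]pres_reprK pres_mul_class cats0. Qed.

Lemma pres_mulVx (T : choiceType) (E : word T -> word T -> Prop) :
  left_inverse (pres_one E) (@pres_inv T E) (@pres_mul T E).
Proof.
move=> x; rewrite -[x]pres_reprK pres_inv_class pres_mul_class.
exact/pres_classP/word_mulV'.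
Qed.

Lemma pres_mulxV (T : choiceType) (E : word T -> word T -> Prop) :
  right_inverse (pres_one E) (@pres_inv T E) (@pres_mul T E).
Proof.
move=> x; rewrite -[x]pres_reprK pres_inv_class pres_mul_class.
exact/pres_classP/word_mulV.
Qed.

HB.instance Definition _ (T : choiceType) (E : word T -> word T -> Prop) :=
  isGroup.Build (presented E) (@pres_mulA T E) (@pres_mul1 T E)
    (@pres_mulr1 T E) (@pres_mulVx T E) (@pres_mulxV T E).

Definition pres_gen (T : choiceType) (E : word T -> word T -> Prop) (x : T) :
  presented E := pres_class E [:: (x, false)].

Definition word_eval (T : Type) (G : groupType) (f : T -> G) (u : word T) : G :=
  \prod_(l <- u) (if l.2 then (f l.1)^-1 else f l.1).

Lemma pres_classE (T : choiceType) (E : word T -> word T -> Prop) u :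
  pres_class E u = word_eval (@pres_gen T E) u.
Proof.
rewrite /word_eval; elim: u => [|[x e] u IHu]; first by rewrite big_nil.
rewrite big_cons -IHu /=.
have -> : (if e then (pres_gen E x)^-1 else pres_gen E x)
          = pres_class E [:: (x, e)].
  by case: e => //; apply: pres_inv_class.
by symmetry; apply: pres_mul_class.
Qed.

Lemma word_eval_cong (T : Type) (E : word T -> word T -> Prop)
    (G : groupType) (f : T -> G) :
    (forall u v, E u v -> word_eval f u = word_eval f v) ->
  forall u v, pres_cong E u v -> word_eval f u = word_eval f v.
Proof.
move=> fE u v; elim=> {u v} [u v /fE|x e|u u' v v' _ IHu _ IHv|//|//|].
- by [].
- rewrite /word_eval !big_cons !big_nil mulg1 /=.
  by case: e; rewrite (mulVg, mulgV).
- by rewrite /word_eval !big_cat /= -/(word_eval f u) IHu -/(word_eval f v) IHv.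
- by move=> v u w _ -> _ ->.
Qed.

Lemma pres_universal (T : choiceType) (E : word T -> word T -> Prop)
    (G : groupType) (f : T -> G) :
    (forall u v, E u v -> word_eval f u = word_eval f v) ->
  exists! h : presented E -> G,
    {morph h : x y / x * y} /\ forall x, h (pres_gen E x) = f x.
Proof.
move=> fE; exists (fun x => word_eval f (pres_repr x)); split.
  have hE u : word_eval f (pres_repr (pres_class E u)) = word_eval f u.
    exact/(word_eval_cong fE)/pres_repr_cong.
  split=> [x y|x]; last by rewrite hE /word_eval big_seq1.
  by rewrite hE /word_eval big_cat.
move=> h [hM hf]; apply/funext => x; rewrite -{2}[x]pres_reprK.
have h1 : h 1 = 1 by apply: (mulgI (h 1)); rewrite -hM !mulg1.
have hV y : h y^-1 = (h y)^-1.
  by apply/esym/mulg1_eq; rewrite -hM mulgV h1.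
rewrite pres_classE /word_eval; elim: (pres_repr x) => [|[y e] u IHu].
  by rewrite !big_nil h1.
by rewrite !big_cons hM -IHu; case: e; rewrite /= ?hV hf.
Qed.

Inductive gen_ab := gen_a | gen_b.

Definition bool_of_gen_ab g := if g is gen_a then true else false.
Definition gen_ab_of_bool t := if t then gen_a else gen_b.

Lemma bool_of_gen_abK : cancel bool_of_gen_ab gen_ab_of_bool.
Proof. by case. Qed.

HB.instance Definition _ := Countable.copy gen_ab (can_type bool_of_gen_abK).

(* b a^n b = a *)
Definition Gamma_rel (n : nat) (u v : word gen_ab) : Prop :=
  u = (gen_b, false) :: nseq n (gen_a, false) ++ [:: (gen_b, false)] /\
  v = [:: (gen_a, false)].

Notation Gamma n := (presented (Gamma_rel n)).

Definition Gamma_a (n : nat) : Gamma n := pres_gen (Gamma_rel n) gen_a.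
Definition Gamma_b (n : nat) : Gamma n := pres_gen (Gamma_rel n) gen_b.

Lemma Gamma_relE (n : nat) :
  Gamma_b n * Gamma_a n ^+ n * Gamma_b n = Gamma_a n.
Proof.
have /pres_classP := Cong_rel (conj erefl erefl : Gamma_rel n _ _).
rewrite !pres_classE /word_eval big_seq1 /= big_cons big_cat /= big_seq1 /=.
by rewrite big_nseq iter_mulg_1 mulgA.
Qed.

Definition semigroup_generated (G : groupType) (S : set G) : set G :=
  [set x | exists s : seq G,
     [/\ s <> [::], forall y, y \in s -> S y & x = \prod_(y <- s) y]].

(* Main.v *)
Require Import Defs.
From HB Require Import structures.
From mathcomp Require Import all_boot ssralg ssrint.
From mathcomp Require Import boolp classical_sets zify.

(** Disjointness reduces to: no nonempty positive word is trivial.  Let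
    c = b a^n; then c^2 = a^(n+1) is central, so b a^j b with j = n mod (n+1) is
    a power of a.  Shortening accordingly, a nonempty positive word equals a
    positive power of a, which survives in the abelianization, or a product that
    becomes, modulo the center, a reduced word of the free product
    Z/2 * Z/(n+1) containing c; the latter moves a vertex of the Bass-Serre tree.
    For the union, b^-1 a = a^n b and a^-1 b = b^-1 a^-n push an inverse letter
    through a positive word without ever increasing the number of b's, which makes
    the process terminate; the negative case is the same statement for
    a^-1, b^-1, which satisfy the same relation. *)

Set Implicit Arguments.
Unset Strict Implicit.
Unset Printing Implicit Defensive.

Local Open Scope group_scope.
Local Open Scope classical_set_scope.

(** * Positive words in two group elements *)

Definition spell (G : groupType) (a b : G) (w : seq bool) : G :=
  \prod_(e <- w) (if e then a else b).

Lemma spell_cat (G : groupType) (a b : G) u v :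
  spell a b (u ++ v) = spell a b u * spell a b v.
Proof. exact: big_cat. Qed.

Lemma spell_cons (G : groupType) (a b : G) e w :
  spell a b (e :: w) = (if e then a else b) * spell a b w.
Proof. exact: big_cons. Qed.

Lemma spell_nseq (G : groupType) (a b : G) k :
  spell a b (nseq k true) = a ^+ k.
Proof. by rewrite /spell big_nseq iter_mulg_1. Qed.

Lemma spell_inv (G : groupType) (a b : G) w :
  (spell a b w)^-1 = spell a^-1 b^-1 (rev w).
Proof.
elim: w => [|e w IHw]; first by rewrite /spell !big_nil invg1.
by rewrite spell_cons invgM IHw rev_cons -cats1 spell_cat /spell big_seq1; case: e.
Qed.

Lemma semigroup_generated_spellP (G : groupType) (a b x : G) :
  semigroup_generated [set a; b] x <-> exists2 w, w <> [::] & x = spell a b w.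
Proof.
split=> [[s [s0 sab ->]]|[w w0 ->]]; last first.
  exists [seq (if e : bool then a else b) | e <- w]; split; last by rewrite /spell big_map.
    by case: w w0.
  by move=> _ /mapP[[] _ ->]; [left|right].
have [w Es] : exists w : seq bool, s = [seq (if e then a else b) | e <- w].
  elim: s sab {s0} => [|y s IHs] sab; first by exists [::].
  have [|w ->] := IHs; first by move=> z zs; apply: sab; rewrite inE zs orbT.
  have [->|->] := sab y (mem_head _ _); first by exists (true :: w).
  by exists (false :: w).
by exists w; rewrite ?Es /spell ?big_map // => w0; rewrite Es w0 in s0.
Qed.

(** * Totality: pushing inverse letters through positive words *)

Section Totality.
Variables (G : groupType) (n : nat).

(** Induction on [m]: a^-1 b = b^-1 a^-n leaves a tail with one b fewer, and the bound on [w'] lets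
    the induction hypothesis be applied to all n letters a^-1 in turn. *)
Lemma mulVa_pos_cases (a b : G) m w :
    b * a ^+ n * b = a -> (count negb w <= m)%N ->
  (exists w', a^-1 * spell a b w = spell a^-1 b^-1 w') \/
  (exists2 w', a^-1 * spell a b w = spell a b w' & (count negb w' <= m)%N).
Proof.
move=> rel; have bVa : b^-1 * a = a ^+ n * b by rewrite -{1}rel -!mulgA mulKg.
have aVb : a^-1 * b = b^-1 * a ^- n by rewrite -{1}rel !invgM -!mulgA mulVg mulg1.
elim: m w => [|m IHm] [|[] w] /= le_wm.
1,4: by left; exists [:: true]; rewrite /spell !big_seq1 big_nil mulg1.
1,3: by right; exists w => //; rewrite spell_cons mulKg.
  by [].
have {IHm} step k : (exists w', a ^- k * spell a b w = spell a^-1 b^-1 w') \/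
    (exists2 w', a ^- k * spell a b w = spell a b w' & (count negb w' <= m)%N).
  elim: k => [|k [[v Ev]|[v Ev le_vm]]].
  - by right; exists w => //; rewrite expg0 invg1 mul1g.
  - by left; exists (true :: v); rewrite spell_cons -Ev expgSr invgM mulgA.
  - by rewrite expgSr invgM -mulgA Ev; apply: IHm.
rewrite spell_cons mulgA aVb -mulgA.
(* The remaining b^-1 extends a negative or empty word, turns a leading a into a^n b (adding one b),
   or cancels a leading b. *)
have [[v ->]|[[|[] v] -> le_vm]] := step n.
- by left; exists (false :: v); rewrite spell_cons.
- by left; exists [:: false]; rewrite /spell big_nil mulg1 big_seq1.
- right; exists (nseq n true ++ false :: v).
    by rewrite spell_cons mulgA bVa spell_cat spell_nseq spell_cons mulgA.
  by rewrite count_cat count_nseq mul0n.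
- right; exists v; first by rewrite spell_cons mulKg.
  by apply: leq_trans (leqW le_vm); apply: leq_addl.
Qed.

Lemma mulVb_pos_cases (a b : G) w : b * a ^+ n * b = a ->
  (exists w', b^-1 * spell a b w = spell a^-1 b^-1 w') \/
  (exists w', b^-1 * spell a b w = spell a b w').
Proof.
move=> rel; have bVa : b^-1 * a = a ^+ n * b by rewrite -{1}rel -!mulgA mulKg.
case: w => [|[] w].
- by left; exists [:: false]; rewrite /spell big_nil mulg1 big_seq1.
- right; exists (nseq n true ++ false :: w).
  by rewrite spell_cons mulgA bVa spell_cat spell_nseq spell_cons mulgA.
- by right; exists w; rewrite spell_cons mulKg.
Qed.

Lemma mulV_letter_pos_cases (a b : G) e w : b * a ^+ n * b = a ->
  (exists w', (if e then a else b)^-1 * spell a b w = spell a^-1 b^-1 w') \/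
  (exists w', (if e then a else b)^-1 * spell a b w = spell a b w').
Proof.
case: e => rel; last exact: mulVb_pos_cases.
have [|[w' -> _]] := mulVa_pos_cases rel (leqnn (count negb w)); first by left.
by right; exists w'.
Qed.

End Totality.

Lemma Gamma_pos_or_neg n (x : Gamma n) :
  let a := Gamma_a n in let b := Gamma_b n in
  (exists w, x = spell a b w) \/ (exists w, x = spell a^-1 b^-1 w).
Proof.
move=> a b; rewrite -[x]pres_reprK pres_classE /word_eval.
have rel : b * a ^+ n * b = a by apply: Gamma_relE.
(* The inverted relation has the same shape, so a negative tail is handled by the lemmas on positive
   words. *)
have relV : b^-1 * a^-1 ^+ n * b^-1 = a^-1.
  by rewrite -[in RHS]rel !invgM expVgn mulgA.
elim: (pres_repr x) => [|[y e] u IHu].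
  by left; exists [::]; rewrite /spell !big_nil.
rewrite big_cons /=; set z := \prod_(_ <- _) _ in IHu *.
have -> : pres_gen (Gamma_rel n) y = if bool_of_gen_ab y then a else b by case: y.
move: (bool_of_gen_ab y) => {}y.
case: e IHu => -[] [w ->].
- by have [|] := mulV_letter_pos_cases y w rel; [right|left].
- right; exists (y :: w); rewrite spell_cons; by case: y.
- by left; exists (y :: w); rewrite spell_cons.
- have [] := mulV_letter_pos_cases y w relV; rewrite ?invgK => -[w' Ew'].
    by left; exists w'; rewrite -Ew'; case: y {Ew'}; rewrite invgK.
  by right; exists w'; rewrite -Ew'; case: y {Ew'}; rewrite invgK.
Qed.

(** * Actions of a presented group, and the infinite order of a *)

Lemma presented_action (T : choiceType) (E : word T -> word T -> Prop) (X : Type)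
    (act : T * bool -> X -> X) :
    (forall x e t, act (x, e) (act (x, ~~ e) t) = t) ->
    (forall u v, E u v -> forall t, foldr act t u = foldr act t v) ->
  exists A : presented E -> X -> X,
    [/\ forall t, A 1 t = t, forall g h t, A (g * h) t = A g (A h t)
      & forall x t, A (pres_gen E x) t = act (x, false) t].
Proof.
move=> actK actE.
have cong u v : pres_cong E u v -> forall t, foldr act t u = foldr act t v.
  elim=> {u v} [u v /actE //|x e t|u u' v v' _ IHu _ IHv t|//|//|v u w _ IHu _ IHv t].
  - exact: actK.
  - by rewrite !foldr_cat IHu IHv.
  - by rewrite IHu.
exists (fun g t => foldr act t (pres_repr g)); split=> [t|g h t|x t].
- exact: (cong _ [::] (pres_repr_cong _ _)).
- by rewrite (cong _ _ (pres_repr_cong _ _)) foldr_cat.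
- exact: (cong _ [:: (x, false)] (pres_repr_cong _ _)).
Qed.

Lemma Gamma_a_expg_neq1 n j : (0 < j)%N -> Gamma_a n ^+ j <> 1.
Proof.
move=> j_gt0.
(* The weights 2 for a and 1 - n for b are compatible with b a^n b = a. *)
pose wt (l : gen_ab * bool) : int :=
  let k : int := if l.1 is gen_a then 2 else (1 - Posz n)%R in if l.2 then (- k)%R else k.
have [||A [A1 AM Agen]] :=
  @presented_action _ (Gamma_rel n) int (fun l t => (wt l + t)%R).
- by move=> x [] t; rewrite /wt /=; case: x; lia.
- move=> u v [-> ->] t /=; rewrite foldr_cat /=.
  have -> k s : foldr (fun l t => (wt l + t)%R) s (nseq k (gen_a, false)) = (s + Posz (2 * k))%R.
    by elim: k => [|k /= ->]; rewrite /wt /=; lia.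
  by rewrite /wt /=; lia.
have Aa k t : A (Gamma_a n ^+ k) t = (t + Posz (2 * k))%R.
  elim: k t => [|k IHk] t; first by rewrite expg0 A1; lia.
  by rewrite expgS AM IHk Agen /wt /=; lia.
by move=> aj1; have := Aa j 0%R; rewrite aj1 A1; lia.
Qed.

(** * Shortening positive words *)

Section ReducedProducts.
Variables (G : groupType) (n : nat) (a b : G).
Hypothesis rel : b * a ^+ n * b = a.

Definition bprod (s : seq nat) : G := \prod_(j <- s) (b * a ^+ j).

(* The last exponent is unconstrained: it is not followed by a b. *)
Fixpoint reduced (s : seq nat) : bool :=
  if s is j :: s' then (nilp s' || (j %% n.+1 != n)%N) && reduced s' else true.

(** Bracketing b a^n b a^n b in two ways shows that b commutes with a^(n+1), so the factor
    a^(i(n+1)) can be moved out. *)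
Lemma rel_expg i : b * a ^+ (n + i * n.+1) * b = a ^+ (i * n.+1).+1.
Proof.
have com : commute b (a ^+ n.+1).
  by rewrite /commute {1}expgSr -[X in a ^+ n * X]rel !mulgA rel -expgS.
rewrite expgnDr mulnC expgnA -!mulgA -(commuteX i com) !mulgA rel.
by rewrite -expgnA -expgS.
Qed.

Lemma spell_reduced w : w <> [::] ->
  exists j s, [/\ spell a b w = a ^+ j * bprod s, reduced s & (0 < j)%N || (s != [::])].
Proof.
elim: w => // e w IHw _.
(* Dropping the nontriviality clause allows the tail to be empty. *)
have {IHw} [j [s [Ew s_red]]] :
    exists j s, spell a b w = a ^+ j * bprod s /\ reduced s.
  case: w IHw => [_|e' w IHw]; last by have [//|j [s [E s_red _]]] := IHw; exists j, s.
  by exists 0, [::]; rewrite /spell /bprod !big_nil mulg1.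
rewrite spell_cons {}Ew.
case: e; first by exists j.+1, s; rewrite expgS mulgA.
have [jn|jn] := boolP (nilp s || (j %% n.+1 != n)%N).
  exists 0, (j :: s); split=> //=; last by rewrite jn.
  by rewrite mul1g /bprod big_cons mulgA.
case: s s_red jn => // k s /= /andP[_ s_red]; rewrite negbK => /eqP jn.
(* With j = q(n+1) + n, the block b a^j b collapses to a^(q(n+1)+1), which absorbs a^k; the
   successor keeps the exponent positive. *)
exists ((j %/ n.+1 * n.+1).+1 + k), s; split=> //.
rewrite /bprod big_cons -/(bprod s) expgnDr -rel_expg !mulgA.
by rewrite {1}(divn_eq j n.+1) jn addnC.
Qed.

End ReducedProducts.

(** * Action on vertices of the Bass-Serre tree *)

Section TreeAction.
Variable n : nat.

Local Notation node := ('I_n.+1 * seq 'I_n)%type.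

(* The pair (k, [:: i1; ..; im]) is the coset of a^k c a^(i1+1) c .. c a^(im+1)
   modulo <c> in Z/2 * Z/(n+1): the entries are shifted so that every pair is in
   normal form.  [flip] and [turn] are left multiplication by c and a. *)
Definition flip (t : node) : node :=
  match unlift ord0 t.1, t.2 with
  | Some i, s => (ord0, i :: s)
  | None, [::] => (ord0, [::])
  | None, i :: s => (lift ord0 i, s)
  end.

Definition turn (t : node) : node := (ordS t.1, t.2).
Definition turnV (t : node) : node := (ord_pred t.1, t.2).

Lemma flipK : involutive flip.
Proof.
case=> k s; rewrite /flip /=; case: (unliftP ord0 k) => [i ->|->] /=; first by rewrite unlift_none.
by case: s => [|i s] /=; rewrite ?unlift_none // liftK.
Qed.

Lemma turnK : cancel turn turnV.
Proof. by case=> k s; rewrite /turnV /= ordSK. Qed.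

Lemma turnVK : cancel turnV turn.
Proof. by case=> k s; rewrite /turn /= ord_predK. Qed.

Lemma val_iter_turn j t : val (iter j turn t).1 = (t.1 + j) %% n.+1.
Proof.
elim: j => [|j IHj]; first by rewrite addn0 modn_small.
by rewrite iterS [LHS]/= IHj -addn1 modnDml addn1 addnS.
Qed.

Lemma iter_turn2 j t : (iter j turn t).2 = t.2.
Proof. by elim: j => //= j ->. Qed.

Lemma iter_turn_period t : iter n.+1 turn t = t.
Proof.
apply: injective_projections; last exact: iter_turn2.
by apply/val_inj; rewrite val_iter_turn modnDr modn_small.
Qed.

Lemma flip_nonzero (t : node) : val t.1 != 0 ->
  (flip t).1 = ord0 /\ size (flip t).2 = (size t.2).+1.
Proof. by case: t => k s; rewrite /flip /=; case: (unliftP ord0 k) => [i ->|->]. Qed.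

(** The letter b acts as c a, since b = c a^-n and a^(n+1) acts trivially. *)
Definition tree_act (l : gen_ab * bool) : node -> node :=
  match l with
  | (gen_a, false) => turn
  | (gen_a, true) => turnV
  | (gen_b, false) => flip \o turn
  | (gen_b, true) => turnV \o flip
  end.

Lemma Gamma_tree_action : exists A : Gamma n -> node -> node,
  [/\ forall t, A 1 t = t, forall g h t, A (g * h) t = A g (A h t),
      forall t, A (Gamma_a n) t = turn t & forall t, A (Gamma_b n) t = flip (turn t)].
Proof.
have [||A [A1 AM Agen]] := @presented_action _ (Gamma_rel n) node tree_act.
- by case=> -[] t /=; rewrite ?turnK ?turnVK ?flipK ?turnK ?turnVK ?flipK.
- move=> u v [-> ->] t /=; rewrite foldr_cat /=.
  have -> k t' : foldr tree_act t' (nseq k (gen_a, false)) = iter k turn t'.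
    by elim: k => //= k ->.
  by rewrite -iterS iter_turn_period flipK.
exists A; split=> // t; exact: Agen.
Qed.

(* With c = b a^n one has b a^j = c a^(j+1) modulo the central c^2 = a^(n+1). *)
Lemma bprod_reduced_neq (n_gt0 : (0 < n)%N) j s : reduced n s -> s != [::] ->
  Gamma_a n ^+ j * bprod (Gamma_a n) (Gamma_b n) s <> 1.
Proof.
move=> s_red s0; have [A [A1 AM Aa Ab]] := Gamma_tree_action.
have Aan k t : A (Gamma_a n ^+ k) t = iter k turn t.
  by elim: k t => [|k IHk] t; rewrite ?expg0 ?A1 // expgS AM IHk Aa.
have Aban k t : A (Gamma_b n * Gamma_a n ^+ k) t = flip (iter k.+1 turn t).
  by rewrite AM Aan Ab.
have [k [Ek1 Ek2]] : exists k, let t := A (bprod (Gamma_a n) (Gamma_b n) s) (k, [::]) in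
    t.1 = ord0 /\ size t.2 = size s.
  elim: s s_red s0 => // i s IHs /= /andP[i_n s_red] _.
  rewrite /bprod; case: s IHs i_n s_red => [_ _ _|i' s IHs i_n s_red].
    (* The last exponent is arbitrary, so the start compensates for it: n i = -i modulo n+1, and
       [i.+1] turns lead to residue 1, nonzero as n > 0. *)
    exists (inord ((n * i) %% n.+1)); rewrite big_seq1 Aban.
    have [|-> ->] := @flip_nonzero (iter i.+1 turn (inord ((n * i) %% n.+1), [::])).
      rewrite val_iter_turn inordK ?ltn_mod // modnDml.
      have -> : (n * i + i.+1 = i * n.+1 + 1)%N by lia.
      by rewrite modnMDl modn_small.
    by rewrite iter_turn2.
  have [k [Ek1 Ek2]] := IHs s_red isT; exists k.
  rewrite big_cons AM Aban -/(bprod _ _ _).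
  set t := A _ _ in Ek1 Ek2 *.
  have [|-> ->] := @flip_nonzero (iter i.+1 turn t); last by rewrite iter_turn2 Ek2.
  (* The previous flip left residue 0, so the residue is now i+1, which vanishes only for i = n
     modulo n+1. *)
  rewrite val_iter_turn Ek1 add0n; apply: contra i_n => /= i_n.
  have := divn_eq i.+1 n.+1; rewrite (eqP i_n) addn0.
  by case: (_ %/ _) => // q; rewrite mulSn addSn addnC => -[->]; rewrite modnMDl modn_small.
(* Powers of a preserve the length, so the product sends a vertex of length 0 to one of positive
   length. *)
move=> /(congr1 (fun g => size (A g (k, [::])).2)).
by rewrite AM Aan iter_turn2 Ek2 A1; case: (s) s0.
Qed.

End TreeAction.

(** * Disjointness and the decomposition *)

Lemma Gamma_spell_neq1 n w : (0 < n)%N -> w <> [::] ->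
  spell (Gamma_a n) (Gamma_b n) w <> 1.
Proof.
move=> n_gt0 /(spell_reduced (Gamma_relE n))[j [s [-> s_red]]].
have [->|s0 _] := eqVneq s [::]; last exact: bprod_reduced_neq.
by rewrite orbF /bprod big_nil mulg1; apply: Gamma_a_expg_neq1.
Qed.

Theorem mainTheorem1 (n : nat) (n_ge1 : (1 <= n)%N) :
  let a := Gamma_a n in
  let b := Gamma_b n in
  let P := semigroup_generated [set a; b] in
  let N := semigroup_generated [set a^-1; b^-1] in
  [/\ [set: Gamma n] = P `|` N `|` [set 1],
      P `&` N = set0,
      P `&` [set 1] = set0
    & N `&` [set 1] = set0].
Proof.
move=> a b P N.
have spell0 c d : spell c d [::] = 1 :> Gamma n by exact: big_nil.
have nP1 u : u <> [::] -> spell a b u <> 1 by exact: Gamma_spell_neq1.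
have nPN u v : u <> [::] -> spell a b u <> spell a^-1 b^-1 v.
  (* The inverse of the negative word is the positive word [rev v], so a coincidence would give a
     nonempty trivial positive word. *)
  move=> u0 E; apply: (nP1 (u ++ rev v)); first by case: u u0 {E}.
  by rewrite spell_cat E -[a]invgK -[b]invgK -spell_inv !invgK mulgV.
split; apply/seteqP; split=> x //=.
- move=> _; have [[[|e w] ->]|[[|e w] ->]] := Gamma_pos_or_neg x; rewrite ?spell0.
  + by right.
  + by left; left; apply/semigroup_generated_spellP; exists (e :: w).
  + by right.
  + by left; right; apply/semigroup_generated_spellP; exists (e :: w).
- by case=> /semigroup_generated_spellP[u u0 ->] /semigroup_generated_spellP[v _]; apply: nPN.
- by case=> /semigroup_generated_spellP[u u0 ->]; apply: nP1.
- case=> /semigroup_generated_spellP[v v0 ->] /(congr1 (@inv _)).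
  rewrite spell_inv !invgK invg1; apply: nP1 => /(congr1 rev).
  by rewrite revK.
Qed.
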